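(* Let $(K,0,1,+,\cdot)$ be a near-domain of characteristic $0$, with multiplicative group $K^\times=K\setminus\{0\}$ and multipliers $d_{a,b}$ for $a,b\in K$. Suppose there is a subgroup $A\le K^\times$ of finite index which avoids all non-trivial $d_{a,b}$, i.e. for all $a,b\in K$, if $d_{a,b}\in A$ then $d_{a,b}=1$. Then $K$ is a near-field.
   Context: A near-domain is a structure $(K,0,1,+,\cdot)$ such that for all $a,b\in K$: (1) $(K,0,+)$ is a loop, i.e. the equations $a+x=b$ and $y+a=b$ have unique solutions, and $a+0=0+a=a$; (2) $(K\setminus\{0\},1,\cdot)$ is a group, and $0\cdot a=a\cdot 0=0$; (3) left distributivity holds: $a\cdot(b+c)=a\cdot b+a\cdot c$ for all $c\in K$; (4) there is $d_{a,b}\in K$ such that $a+(b+x)=(a+b)+d_{a,b}\cdot x$ for all $x\in K$. The element $d_{a,b}$ is uniquely determined by $a,b$. A near-field is a near-domain whose addition is associative. The element $1$ generates a subfield of $K$ (a subset containing $0$ and $1$ which is a field under the restrictions of $+$ and $\cdot$), which is isomorphic either to $\mathbb{Q}$ or to $\mathbb{F}_p$ for a prime $p$; the characteristic of $K$ is the characteristic of this field. Thus $K$ has characteristic $0$ if the subfield generated by $1$ is isomorphic to $\mathbb{Q}$. *)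

(* Defs.v *)
From mathcomp Require Import all_boot all_order all_algebra.
From mathcomp Require Import boolp classical_sets functions cardinality.
Set Implicit Arguments.
Unset Strict Implicit.
Unset Printing Implicit Defensive.

Local Open Scope classical_set_scope.

(* [S] is a group with identity [e] under the restriction of [op] to [S]. *)
Definition group_on (T : Type) (S : set T) (e : T) (op : T -> T -> T) : Prop :=
  [/\ S e,
      forall x y, S x -> S y -> S (op x y),
      forall x y z, S x -> S y -> S z -> op x (op y z) = op (op x y) z,
      forall x, S x -> op e x = x /\ op x e = x
    & forall x, S x -> exists y, [/\ S y, op x y = e & op y x = e] ].

Definition is_loop (T : Type) (e : T) (op : T -> T -> T) : Prop :=
  [/\ forall a b, exists! x, op a x = b,
      forall a b, exists! y, op y a = b
    & forall a, op a e = a /\ op e a = a ].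

Declare Scope near_domain_scope.
Delimit Scope near_domain_scope with ND.

Record nearDomain := NearDomain {
  nd_sort :> Type;
  nd_zero : nd_sort;
  nd_one : nd_sort;
  nd_add : nd_sort -> nd_sort -> nd_sort;
  nd_mul : nd_sort -> nd_sort -> nd_sort;
  nd_loop : is_loop nd_zero nd_add;
  nd_group : group_on [set x | x <> nd_zero] nd_one nd_mul;
  nd_mul0 : forall a, nd_mul nd_zero a = nd_zero /\ nd_mul a nd_zero = nd_zero;
  nd_distl : forall a b c,
    nd_mul a (nd_add b c) = nd_add (nd_mul a b) (nd_mul a c);
  nd_multiplier : forall a b, exists d, forall x,
    nd_add a (nd_add b x) = nd_add (nd_add a b) (nd_mul d x)
}.

Notation "0" := (nd_zero _) : near_domain_scope.
Notation "1" := (nd_one _) : near_domain_scope.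
Notation "x + y" := (nd_add x y) : near_domain_scope.
Notation "x * y" := (nd_mul x y) : near_domain_scope.
Local Open Scope near_domain_scope.

Definition nd_units (K : nearDomain) : set K := [set x | x <> 0].

(* The element d_{a,b}; the choice is harmless by [multiplier_unique]. *)
Definition multiplier (K : nearDomain) (a b : K) : K :=
  projT1 (cid (nd_multiplier a b)).

Lemma multiplierP (K : nearDomain) (a b x : K) :
  a + (b + x) = (a + b) + multiplier a b * x.
Proof. exact: (projT2 (cid (nd_multiplier a b))). Qed.

Lemma nd_mulr1 (K : nearDomain) (d : K) : d * 1 = d.
Proof.
have [_ _ _ h _] := nd_group K.
have [->|d0] := pselect (d = 0); first by have [] := nd_mul0 (1 : K).
by have [] := h d d0.
Qed.

Lemma multiplier_unique (K : nearDomain) (a b d : K) :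
  (forall x, a + (b + x) = (a + b) + d * x) -> d = multiplier a b.
Proof.
move=> hd; have [h _ _] := nd_loop K.
have [z [_ zu]] := h (a + b) (a + (b + 1)).
rewrite -[d]nd_mulr1 -[multiplier a b]nd_mulr1.
by rewrite -(zu _ (esym (hd 1))) -(zu _ (esym (multiplierP a b 1))).
Qed.

Definition is_near_field (K : nearDomain) : Prop :=
  forall a b c : K, a + (b + c) = (a + b) + c.

Definition is_subfield (K : nearDomain) (S : set K) : Prop :=
  [/\ group_on S 0 (@nd_add K),
      forall x y, S x -> S y -> x + y = y + x,
      group_on (S `&` @nd_units K) 1 (@nd_mul K),
      forall x y, S x -> S y -> x * y = y * x
    & forall x y z, S x -> S y -> S z -> x * (y + z) = x * y + x * z ].

Definition prime_subfield (K : nearDomain) : set K :=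
  [set x | forall S : set K, is_subfield S -> S x].

Definition has_characteristic0 (K : nearDomain) : Prop :=
  exists f : rat -> K,
    [/\ set_bij setT (@prime_subfield K) f,
        f 0%R = 0, f 1%R = 1,
        forall x y, f (x + y)%R = f x + f y
      & forall x y, f (x * y)%R = f x * f y ].

Definition is_subgroup (K : nearDomain) (A : set K) : Prop :=
  A `<=` @nd_units K /\ group_on A 1 (@nd_mul K).

Definition left_coset (K : nearDomain) (g : K) (A : set K) : set K :=
  [set g * a | a in A].

Definition finite_index (K : nearDomain) (A : set K) : Prop :=
  finite_set [set left_coset g A | g in @nd_units K].

(* Main.v *)
Require Import Defs.
From mathcomp Require Import all_boot all_order all_algebra.
From mathcomp Require Import boolp classical_sets functions cardinality.
From mathcomp Require Import ring.
Set Implicit Arguments.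
Unset Strict Implicit.
Unset Printing Implicit Defensive.

(** Write [tau a] for the translation [x |-> a + x], so that
[tau a \o tau b = tau (a + b) \o (multiplier a b * _)], and embed the
rationals in [K] by an [f] whose image is the prime field. Each line [b * f x]
([x] rational) is an honest additive group, as are its translations.

The finite index of [A] enters through the colouring of a multiplier by its
left coset of [A]. If [p = multiplier a (b * f x)] and
[q = multiplier a (b * f y)] lie in the same coset, then [q^-1 p] lies in [A];
but [q^-1 p] is itself a multiplier ([multiplier_of_sums]), hence it is [1].
So on a line [multiplier a] takes only finitely many values, and the colour
determines the value ([coset_separates]). When both values are equal to [d],
the sums [- (a + b * f x)] and [a + b * f y] have multiplier [1], so their
translations commute, and this unfolds to
[tau a \o tau (b * f z) \o (tau a)^-1 = tau (d * (b * f z))] for [z = y - x]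
([equal_multipliers_conjugate]): conjugation by [tau a] acts on this
translation like the multiplication by [d].

The rationals are infinite, so the pigeonhole principle produces such
coincidences. Applied to the colours at [x], [x + z] and [x + 1] it shows that
[d] can be taken the same for [z] and [1] ([common_conjugator]); in particular
[tau a] commutes with [tau b] as soon as it commutes with [tau (b * f z)] for
one [z != 0] ([commute_divide]). Applied to the grid
[multiplier (a * f x) (b * f y)], it finds two points [a * f x] and [a * f x']
whose translations conjugate some [tau (b * f z)] in the same way; hence
[tau (a * f (x - x'))] commutes with [tau (b * f z)] ([commuting_multiples]).
Dividing on both sides, all translations commute.

Commutation yields associativity through
[a + b = multiplier a b * (b + a)] ([multiplier_swap]). That identity is what
needs [- 1] to be central, and [- 1] is central because it is the only
involution of the multiplicative group ([involution_eqN1]). *)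

Import GRing.Theory.
Local Open Scope classical_set_scope.
Local Open Scope near_domain_scope.

(** * Arithmetic of near-domains *)

Lemma nd_addI (K : nearDomain) (a x y : K) : a + x = a + y -> x = y.
Proof.
have [h _ _] := nd_loop K; have [z [_ zu]] := h a (a + x).
by move=> e; rewrite -(zu x erefl) (zu y (esym e)).
Qed.

Lemma nd_subtract (K : nearDomain) (a b : K) : exists x, a + x = b.
Proof. by have [h _ _] := nd_loop K; have [z [zP _]] := h a b; exists z. Qed.

Lemma nd_addr0 (K : nearDomain) (a : K) : a + 0 = a.
Proof. by have [_ _ h] := nd_loop K; have [] := h a. Qed.

Lemma nd_add0r (K : nearDomain) (a : K) : 0 + a = a.
Proof. by have [_ _ h] := nd_loop K; have [] := h a. Qed.

Lemma nd_mul0r (K : nearDomain) (a : K) : 0 * a = 0.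
Proof. by have [] := nd_mul0 a. Qed.

Lemma nd_mulr0 (K : nearDomain) (a : K) : a * 0 = 0.
Proof. by have [] := nd_mul0 a. Qed.

Lemma nd_mul1r (K : nearDomain) (a : K) : 1 * a = a.
Proof.
have [->|a0] := pselect (a = 0); first by rewrite nd_mulr0.
by have [_ _ _ h _] := nd_group K; have [] := h a a0.
Qed.

Lemma nd_mulA (K : nearDomain) (a b c : K) : a * (b * c) = a * b * c.
Proof.
have [->|a0] := pselect (a = 0); first by rewrite !nd_mul0r.
have [->|b0] := pselect (b = 0); first by rewrite nd_mulr0 !nd_mul0r nd_mulr0.
have [->|c0] := pselect (c = 0); first by rewrite !nd_mulr0.
by have [_ _ h _ _] := nd_group K; apply: h.
Qed.

Lemma nd_inverse (K : nearDomain) (a : K) : a <> 0 ->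
  exists b, [/\ b <> 0, a * b = 1 & b * a = 1].
Proof.
by move=> a0; have [_ _ _ _ h] := nd_group K; have [b [? ? ?]] := h a a0; exists b.
Qed.

Lemma nd_mul_neq0 (K : nearDomain) (a b : K) : a <> 0 -> b <> 0 -> a * b <> 0.
Proof. by have [_ h _ _ _] := nd_group K; apply: h. Qed.

Lemma nd_mulI (K : nearDomain) (a x y : K) : a <> 0 -> a * x = a * y -> x = y.
Proof.
move=> /nd_inverse [b [_ _ ba]] e.
by rewrite -[x]nd_mul1r -[y]nd_mul1r -ba -!nd_mulA e.
Qed.

Lemma nd_mulIr (K : nearDomain) (a x y : K) : a <> 0 -> x * a = y * a -> x = y.
Proof.
move=> /nd_inverse [b [_ ab _]] e.
by rewrite -[x]nd_mulr1 -[y]nd_mulr1 -ab !nd_mulA e.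
Qed.

Lemma nd_one_neq0 (K : nearDomain) : (1 : K) <> 0.
Proof. by have [] := nd_group K. Qed.

Lemma multiplier_neq0 (K : nearDomain) (a b : K) : multiplier a b <> 0.
Proof.
move=> d0; apply: (@nd_one_neq0 K).
apply: (@nd_addI _ b); apply: (@nd_addI _ a).
by rewrite !multiplierP d0 !nd_mul0r.
Qed.

(** The group of affine maps is sharply [2]-transitive: after recentring at [u]
each of the maps becomes [y |-> w + d * y], and a second point determines [d]. *)
Lemma affine_eq (K : nearDomain) (a b a' b' u v : K) : u <> v ->
  a + b * u = a' + b' * u -> a + b * v = a' + b' * v ->
  forall x, a + b * x = a' + b' * x.
Proof.
move=> uv eu ev.
have expand c d y :
    c + d * (u + y) = (c + d * u) + multiplier c (d * u) * d * y.
  by rewrite nd_distl multiplierP nd_mulA.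
have [w wv] := nd_subtract u v.
have w0 : w <> 0 by move=> w0; apply: uv; rewrite -wv w0 nd_addr0.
have slope :
    multiplier a (b * u) * b = multiplier a' (b' * u) * b'.
  apply: (nd_mulIr w0); apply: (@nd_addI _ (a + b * u)).
  by rewrite -expand wv ev -wv expand eu.
by move=> x; have [y <-] := nd_subtract u x; rewrite !expand slope eu.
Qed.

(** * The rational prime field *)

(** The prime field of characteristic [0], presented by its parametrization:
[f q] plays the role of the rational number [q] inside [K]. *)
Definition rational_embedding (K : nearDomain) (f : rat -> K) : Prop :=
  [/\ injective f, f 0%R = 0, f 1%R = 1,
      {morph f : x y / (x + y)%R >-> x + y}
    & {morph f : x y / (x * y)%R >-> x * y}].

Lemma char0_embedding (K : nearDomain) : has_characteristic0 K ->
  exists f : rat -> K, rational_embedding f.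
Proof.
move=> [f [[_ fI _] f0 f1 fD fM]]; exists f; split=> //.
by move=> x y; apply: fI; rewrite inE.
Qed.

Lemma emb_neq0 (K : nearDomain) (f : rat -> K) (x : rat) :
  rational_embedding f -> x != 0%R -> f x <> 0.
Proof. by move=> [fI f0 _ _ _] /eqP x0 e; apply: x0; apply: fI; rewrite f0. Qed.

(** Translations by elements of one line [b * f _] compose without multiplier:
testing the multiplier on the element [b] of that line involves only additions
of rationals. *)
Lemma emb_addA (K : nearDomain) (f : rat -> K) : rational_embedding f ->
  forall b x y t, b * f x + (b * f y + t) = b * f (x + y)%R + t.
Proof.
move=> [_ _ f1 fD _] b x y t.
have [->|b0] := pselect (b = 0); first by rewrite !nd_mul0r !nd_add0r.
have h : multiplier (b * f x) (b * f y) * b = b.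
  apply: (@nd_addI _ (b * f x + b * f y)).
  rewrite -multiplierP -{3 6}[b]nd_mulr1 -f1 -!nd_distl -!fD.
  by congr (b * f _); ring.
rewrite multiplierP -nd_distl -fD; congr (_ + _).
by rewrite -[RHS]nd_mul1r; congr (_ * _); apply: (nd_mulIr b0); rewrite h nd_mul1r.
Qed.

Lemma emb_addK (K : nearDomain) (f : rat -> K) : rational_embedding f ->
  forall b x t, b * f x + (b * f (- x)%R + t) = t.
Proof.
move=> fP b x t; rewrite emb_addA // subrr.
by case: fP => _ -> *; rewrite nd_mulr0 nd_add0r.
Qed.

Lemma nd_addKN (K : nearDomain) (f : rat -> K) : rational_embedding f ->
  forall a t, a * f (-1)%R + (a + t) = t.
Proof.
move=> fP a t; have := emb_addK fP a (-1)%R t; rewrite opprK.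
by case: fP => _ _ -> *; rewrite -{2}[a]nd_mulr1.
Qed.

Lemma nd_addNK (K : nearDomain) (f : rat -> K) : rational_embedding f ->
  forall a t, a + (a * f (-1)%R + t) = t.
Proof.
move=> fP a t; have := emb_addK fP a 1%R t.
by case: fP => _ _ -> *; rewrite -{1}[a]nd_mulr1.
Qed.

Lemma nd_addNr (K : nearDomain) (f : rat -> K) : rational_embedding f ->
  forall a, a + a * f (-1)%R = 0.
Proof. by move=> fP a; rewrite -[a * _]nd_addr0 nd_addNK. Qed.

(** An involution [c != 1] is conjugate, by an affine map, to the reflection
[x |-> 1 - x]. The conjugation carries the fixed point [0] of [c] to a fixed
point of the reflection, which can only be [1 / 2]; this determines the affine
map, and hence [c]. *)
Lemma involution_eqN1 (K : nearDomain) (f : rat -> K) (c : K) :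
  rational_embedding f -> c * c = 1 -> c <> 1 -> c = f (-1)%R.
Proof.
move=> fP cc c1; have [fI f0 f1 fD fM] := fP.
set e := f (-1)%R.
have ee : e * e = 1 by rewrite -fM -f1; congr f; ring.
have e1 : 1 + e = 0 by rewrite -f1 -fD -f0; congr f; ring.
have e1' : e + 1 = 0 by rewrite -f1 -fD -f0; congr f; ring.
have ec0 : e + c <> 0.
  by move=> h; apply: c1; apply: (@nd_addI _ e); rewrite h e1'.
have [b [b0 eb be]] := nd_inverse ec0.
(* The affine map sending [1] to [0] and [c] to [1] carries multiplication by [c]
   to the reflection [x |-> 1 - x], as both exchange the same two points. *)
have conj0 : b * e = 1 + e * (b * e).
  have c1' : 1 <> c by move=> h; apply: c1.
  have := @affine_eq _ (b * e) (b * c)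
    (1 + e * (b * e)) (multiplier 1 (e * (b * e)) * (e * b)) 1 c c1' _ _ 0.
  rewrite !nd_mulr0 !nd_addr0; apply.
    rewrite !nd_mulr1 -multiplierP -!nd_distl be.
    by rewrite -{2}[b]nd_mulr1 -nd_distl e1' !nd_mulr0 nd_addr0.
  rewrite -!nd_mulA -multiplierP -!nd_distl cc be e1' nd_mulr0.
  by rewrite nd_mulr1 e1.
(* Evaluating at [0], [b * e] is fixed by the reflection. *)
have half : b * e = f (1 / 2)%R.
  apply: contrapT => ne.
  have := @affine_eq _ 1 e 0 1 _ _ ne; rewrite !nd_mul1r !nd_add0r => h.
  have /(_ 0) : forall x, 1 + e * x = 1 * x.
    move=> x; rewrite h ?nd_add0r //.
    by rewrite /e -fM -f1 -fD; congr f; field.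
  by rewrite nd_mulr0 nd_addr0 nd_mulr0; exact: nd_one_neq0.
have bE : b = f (- (1 / 2))%R.
  by rewrite -[b]nd_mulr1 -ee nd_mulA half /e -fM; congr f; field.
apply: (@nd_addI _ e); apply: (nd_mulI b0); rewrite be bE /e -fD -fM -f1.
by congr f; field.
Qed.

(** The conjugates of the involution [f (-1)] are involutions, so they coincide
with it. *)
Lemma embN1_central (K : nearDomain) (f : rat -> K) : rational_embedding f ->
  forall a, a * f (-1)%R = f (-1)%R * a.
Proof.
move=> fP a; have [fI _ f1 _ fM] := fP.
have [->|a0] := pselect (a = 0); first by rewrite nd_mul0r nd_mulr0.
have [b [b0 ab ba]] := nd_inverse a0.
have ee : f (-1)%R * f (-1)%R = 1 by rewrite -fM -f1; congr f; ring.
have conjE : a * f (-1)%R * b = f (-1)%R; last first.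
  by rewrite -{2}conjE -!nd_mulA ba nd_mulr1.
apply: (involution_eqN1 fP).
  by rewrite -!nd_mulA (nd_mulA b) ba nd_mul1r (nd_mulA (f _)) ee nd_mul1r.
move=> h; have : a * f (-1)%R = a * f 1%R.
  by rewrite f1 nd_mulr1 -[LHS]nd_mulr1 -ba nd_mulA h nd_mul1r.
by move/(nd_mulI a0)/fI.
Qed.

(** Apply [tau a \o tau b] to [- b - a]: the result is [0], while centrality of
[- 1] identifies [- b - a] with [- (b + a)]. *)
Lemma multiplier_swap (K : nearDomain) (f : rat -> K) : rational_embedding f ->
  forall a b : K, multiplier a b * (b + a) = a + b.
Proof.
move=> fP a b.
have e0 : f (-1)%R <> 0 by apply: emb_neq0.
apply: (nd_mulIr e0); apply: (@nd_addI _ (a + b)); rewrite nd_addNr //.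
rewrite -nd_mulA (embN1_central fP) nd_distl -(embN1_central fP b).
rewrite -(embN1_central fP a).
by rewrite -multiplierP nd_addNK // nd_addNr.
Qed.

Lemma multiplier_opp (K : nearDomain) (f : rat -> K) : rational_embedding f ->
  forall a b : K, a + b = 0 -> multiplier a b = 1.
Proof.
move=> fP a b ab; apply/esym/multiplier_unique => x.
have -> : b = a * f (-1)%R by apply: (@nd_addI _ a); rewrite ab nd_addNr.
by rewrite nd_addNK // nd_addNr // nd_mul1r nd_add0r.
Qed.

(** If [a + b] is nonzero, swapping twice and cancelling it gives the claim;
otherwise both multipliers are [1]. *)
Lemma multiplierV (K : nearDomain) (f : rat -> K) : rational_embedding f ->
  forall a b : K, multiplier a b * multiplier b a = 1.
Proof.
move=> fP a b; have [ab|ab] := pselect (a + b = 0); last first.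
  by apply: (nd_mulIr ab); rewrite -nd_mulA !(multiplier_swap fP) nd_mul1r.
have ba : b + a = 0.
  by apply: (nd_mulI (@multiplier_neq0 _ a b)); rewrite (multiplier_swap fP) nd_mulr0.
by rewrite !(multiplier_opp fP) // nd_mulr1.
Qed.

(** * Conjugation of translations *)

(** [tau a \o tau s = tau s' \o tau a], that is, conjugation by the translation
[tau a] turns [tau s] into [tau s']. In particular [conjugates a s s] says that
the translations by [a] and [s] commute. *)
Definition conjugates (K : nearDomain) (a s s' : K) : Prop :=
  forall t, a + (s + t) = s' + (a + t).

Lemma conjugates_inj (K : nearDomain) (a s s1 s2 : K) :
  conjugates a s s1 -> conjugates a s s2 -> s1 = s2.
Proof.
move=> h1 h2; have [t t0] := nd_subtract a 0.
by rewrite -[s1]nd_addr0 -[s2]nd_addr0 -t0 -h1.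
Qed.

Lemma multiplier1_commute (K : nearDomain) (f : rat -> K) (a b : K) :
  rational_embedding f -> multiplier a b = 1 -> conjugates a b b.
Proof.
move=> fP ab1 t; have ba1 : multiplier b a = 1.
  by rewrite -(multiplierV fP a b) ab1 nd_mul1r.
by rewrite !multiplierP -(multiplier_swap fP a b) ab1 ba1 !nd_mul1r.
Qed.

(** The composite [tau (- (a + b * f x)) \o tau (a + b * f y)] differs from the
translation by [b * f (y - x)] only by the two multipliers: both sums start
with [a], which cancels. *)
Lemma difference_of_sums (K : nearDomain) (f : rat -> K) (a b : K) (x y : rat) :
  rational_embedding f -> forall t,
  (a + b * f x) * f (-1)%R + ((a + b * f y) + multiplier a (b * f y) * t)
  = multiplier a (b * f x) * (b * f (y - x)%R + t).
Proof.
move=> fP t; rewrite -multiplierP.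
have -> : b * f y + t = b * f x + (b * f (y - x)%R + t).
  by rewrite emb_addA // [(x + _)%R]addrC subrK.
by rewrite (multiplierP a) (nd_addKN fP).
Qed.

(** By [difference_of_sums], the multiplier of [- (a + b * f x)] and
[a + b * f y] is [p * q^-1], where [p = q * r]; multiplying both arguments by
[q^-1] conjugates it to [q^-1 * p = r]. *)
Lemma multiplier_of_sums (K : nearDomain) (f : rat -> K) (a b r : K) (x y : rat) :
  rational_embedding f ->
  multiplier a (b * f x) = multiplier a (b * f y) * r ->
  exists s t : K, multiplier s t = r.
Proof.
move=> fP; set p := multiplier a (b * f x); set q := multiplier a (b * f y) => pE.
have [q' [q'0 qq' q'q]] := nd_inverse (@multiplier_neq0 _ a (b * f y)).
exists (q' * ((a + b * f x) * f (-1)%R)), (q' * (a + b * f y)).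
apply/esym/multiplier_unique => t; rewrite -nd_distl.
have := difference_of_sums a b x y fP 0; rewrite !(nd_mulr0, nd_addr0) => ->.
rewrite -{1}[t]nd_mul1r -q'q -nd_mulA -!nd_distl difference_of_sums //.
by rewrite -/p nd_distl nd_distl pE !nd_mulA q'q nd_mul1r.
Qed.

(** Put [u = a + b * f x] and [v = a + b * f y]. The equality of the two
multipliers makes the multiplier of [- u] and [v] trivial, so that [tau (- u)]
and [tau v] commute. Hence [tau v = tau c \o tau u] with
[c = - u + v = d * (b * f (y - x))], and it remains to expand [u] and [v]. *)
Lemma equal_multipliers_conjugate (K : nearDomain) (f : rat -> K) (a b d : K)
    (x y : rat) : rational_embedding f ->
  multiplier a (b * f x) = d -> multiplier a (b * f y) = d ->
  conjugates a (b * f (y - x)%R) (d * (b * f (y - x)%R)).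
Proof.
move=> fP dx dy t.
set u := a + b * f x; set v := a + b * f y; set c := d * (b * f (y - x)%R).
have diff r : u * f (-1)%R + (v + r) = c + r.
  have d0 : d <> 0 by rewrite -dx; exact: multiplier_neq0.
  have [d' [_ dd' _]] := nd_inverse d0.
  have := difference_of_sums a b x y fP (d' * r).
  by rewrite dx dy nd_distl nd_mulA dd' nd_mul1r.
have diff0 : u * f (-1)%R + v = c by have := diff 0; rewrite !nd_addr0.
have comm : multiplier (u * f (-1)%R) v = 1.
  by apply/esym/multiplier_unique => r; rewrite diff diff0 nd_mul1r.
have shift r : v + r = c + (u + r).
  by rewrite -diff (multiplier1_commute fP comm) (nd_addKN fP).
(* This argument of [shift] undoes the part [b * f x] of [u]. *)
have := shift (d * (b * f (- x)%R + t)).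
rewrite -{1}dy -dx -!multiplierP emb_addK // emb_addA //.
Qed.

(** * Colouring multipliers by cosets *)

(** This finite colouring is the only trace of the subgroup [A] in the
combinatorial part of the proof. *)
Definition separates_multipliers (K : nearDomain) (f : rat -> K) (C : finType)
    (k : K -> C) : Prop :=
  forall a b x y, k (multiplier a (b * f x)) = k (multiplier a (b * f y)) ->
    multiplier a (b * f x) = multiplier a (b * f y).

Lemma coset_coloring (K : nearDomain) (A : set K) : finite_index A ->
  exists (n : nat) (k : K -> 'I_n.+1), forall p q, p <> 0 -> q <> 0 ->
    k p = k q -> left_coset p A = left_coset q A.
Proof.
move=> /finite_seqP [s sE].
have mem p : p <> 0 -> left_coset p A \in s.
  move=> p0; have : [set` s] (left_coset p A) by rewrite -sE; exists p.
  by [].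
exists (size s), (fun p => inord (index (left_coset p A) s)) => p q p0 q0.
move=> /(congr1 val); rewrite /= !inordK ?ltnS ?index_size // => e.
by rewrite -(nth_index set0 (mem p p0)) e nth_index // mem.
Qed.

(** Two multipliers in the same left coset differ by an element of [A] that is
again a multiplier, hence trivial. *)
Lemma coset_separates (K : nearDomain) (f : rat -> K) (A : set K) (C : finType)
    (k : K -> C) :
  rational_embedding f -> is_subgroup A ->
  (forall a b : K, A (multiplier a b) -> multiplier a b = 1) ->
  (forall p q, p <> 0 -> q <> 0 -> k p = k q ->
    left_coset p A = left_coset q A) ->
  separates_multipliers f k.
Proof.
move=> fP [_ [A1 _ _ _ _]] avoidA kP a b x y e.
have [r Ar pE] : left_coset (multiplier a (b * f y)) A (multiplier a (b * f x)).
  rewrite -(kP _ _ _ _ e); [|exact: multiplier_neq0..].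
  by exists 1 => //; rewrite nd_mulr1.
have [s [t rE]] := multiplier_of_sums fP (esym pE).
by rewrite -pE -rE (avoidA s t) ?rE // nd_mulr1.
Qed.

Lemma pigeonhole (C : finType) (g : nat -> C) :
  exists i j : nat, [/\ (i < j)%N, (j <= #|C|)%N & g i = g j].
Proof.
have /injectivePn [i [j ij e]] : ~~ injectiveb (fun i : 'I_#|C|.+1 => g i).
  apply/negP => /injectiveP /leq_card; by rewrite card_ord ltnn.
have [lt|lt|/val_inj eq] := ltngtP i j; last by rewrite eq eqxx in ij.
  by exists i, j; split=> //; exact: (ltn_ord j).
by exists j, i; split=> //; exact: (ltn_ord i).
Qed.

Lemma natr_diff_neq0 (i j : nat) : (i < j)%N -> (j%:R - i%:R != 0 :> rat)%R.
Proof. by move=> ij; rewrite subr_eq0 Num.Theory.eqr_nat gtn_eqF. Qed.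

(** Two integers [i < j] such that the colours at [i], [i + z], [i + 1] agree
with those at [j], [j + z], [j + 1] give three conjugation factors for the same
translation by [b * f (j - i)]; so they are equal, and comparing the multipliers
at [i] and [i + w], for [w = z] or [w = 1], gives this factor for [b * f w]. *)
Lemma common_conjugator (K : nearDomain) (f : rat -> K) (C : finType) (k : K -> C) :
  rational_embedding f -> separates_multipliers f k ->
  forall (a b : K) (z : rat), b <> 0 ->
  exists d, conjugates a (b * f z) (d * (b * f z)) /\ conjugates a b (d * b).
Proof.
move=> fP kP a b z b0; pose m x := multiplier a (b * f x).
pose color x := k (m x).
have [i [j [ij _ [e0 ez e1]]]] := pigeonhole
  (fun i : nat => (color i%:R%R, color (i%:R + z)%R, color (i%:R + 1)%R)).
have repeat w : color (i%:R + w)%R = color (j%:R + w)%R -> m (i%:R + w)%R = m i%:R%R.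
  move=> ew.
  have h0 := equal_multipliers_conjugate fP erefl (esym (kP _ _ _ _ e0)).
  have hw := equal_multipliers_conjugate fP erefl (esym (kP _ _ _ _ ew)).
  move: hw; rewrite [(_ - _)%R](_ : _ = j%:R - i%:R)%R; last by ring.
  move=> /(conjugates_inj h0) /nd_mulIr h; apply/esym/h.
  by apply: nd_mul_neq0 => //; apply/emb_neq0/natr_diff_neq0.
have conj w : color (i%:R + w)%R = color (j%:R + w)%R ->
    conjugates a (b * f w) (m i%:R%R * (b * f w)).
  move=> /repeat ew; have := equal_multipliers_conjugate fP erefl ew.
  by rewrite [(_ + w - _)%R]addrC addKr.
exists (m i%:R%R); split; first exact: conj.
by have := conj 1%R e1; case: (fP) => _ _ -> *; rewrite -[b]nd_mulr1.
Qed.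

Lemma commute_divide (K : nearDomain) (f : rat -> K) (C : finType) (k : K -> C) :
  rational_embedding f -> separates_multipliers f k ->
  forall (a b : K) (z : rat), b <> 0 -> z != 0%R ->
  conjugates a (b * f z) (b * f z) -> conjugates a b b.
Proof.
move=> fP kP a b z b0 z0 h.
have [d [hz]] := common_conjugator fP kP a z b0.
have bz0 : b * f z <> 0 by apply: nd_mul_neq0 => //; apply: emb_neq0.
have -> : d = 1 by apply: (nd_mulIr bz0); rewrite nd_mul1r (conjugates_inj hz h).
by rewrite nd_mul1r.
Qed.

(** Colour a column [j] of the grid [multiplier (a * f i) (b * f j)] by the
colours of its first [#|C| + 1] entries. Two columns agree, so that each of the
translations by [a * f i] conjugates [b * f (j' - j)] by a factor [m i j]. There
are more rows than colours, hence two rows have the same factor (the colour is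
read off the inverse factor, since colours separate multipliers only in their
second argument). The quotient of these two translations commutes with the
translation by [b * f (j' - j)]. *)
Lemma commuting_multiples (K : nearDomain) (f : rat -> K) (C : finType) (k : K -> C) :
  rational_embedding f -> separates_multipliers f k ->
  forall a b : K, exists x y : rat, [/\ x != 0%R, y != 0%R
    & conjugates (a * f x) (b * f y) (b * f y)].
Proof.
move=> fP kP a b.
pose m (i j : nat) := multiplier (a * f i%:R%R) (b * f j%:R%R).
have [j [j' [jj' _ /ffunP col]]] := pigeonhole
  (fun j : nat => [ffun i : 'I_#|C|.+1 => k (m i j)]).
have [i [i' [ii' i'C row]]] := pigeonhole
  (fun i : nat => k (multiplier (b * f j%:R%R) (a * f i%:R%R))).
have same : m i j = m i' j.
  apply: (nd_mulIr (@multiplier_neq0 _ (b * f j%:R%R) (a * f i%:R%R))).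
  by rewrite [in RHS](kP _ _ _ _ row) /m !(multiplierV fP).
have colE l : (l <= #|C|)%N -> m l j' = m l j.
  move=> lC; have := col (Ordinal (lC : (l < #|C|.+1)%N)).
  by rewrite !ffunE => /kP.
have h := equal_multipliers_conjugate fP erefl
  (colE i (ltnW (leq_trans ii' i'C))).
have h' := equal_multipliers_conjugate fP erefl (colE i' i'C).
rewrite -/(m i j) in h; rewrite -/(m i' j) -same in h'.
exists (i%:R - i'%:R)%R, (j'%:R - j%:R)%R; split.
- by rewrite -opprB oppr_eq0 natr_diff_neq0.
- exact: natr_diff_neq0.
move=> t; rewrite [(i%:R - _)%R]addrC -!(emb_addA fP a) h.
apply: (@nd_addI _ (a * f i'%:R%R)); rewrite emb_addK //.
by rewrite h' emb_addK.
Qed.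

Theorem proposition5 (K : nearDomain) (charK : has_characteristic0 K)
    (A : set K) (subA : is_subgroup A) (indexA : finite_index A)
    (avoidA : forall a b : K, A (multiplier a b) -> multiplier a b = nd_one K) :
  is_near_field K.
Proof.
have [f fP] := char0_embedding charK.
have [n [k kA]] := coset_coloring indexA.
have kP := coset_separates fP subA avoidA kA.
have comm (a b : K) : conjugates a b b.
  have [->|a0] := pselect (a = 0); first by move=> t; rewrite !nd_add0r.
  have [->|b0] := pselect (b = 0); first by move=> t; rewrite !nd_add0r.
  have [x [y [x0 y0 /(commute_divide fP kP b0 y0) h]]] := commuting_multiples fP kP a b.
  have {}h : conjugates b (a * f x) (a * f x) by move=> t; rewrite h.
  by move=> t; rewrite (commute_divide fP kP a0 x0 h).
move=> a b c; have [ab|ab] := pselect (a + b = 0).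
  by rewrite multiplierP (multiplier_opp fP ab) nd_mul1r.
have swap : a + b = b + a by have := comm a b 0; rewrite !nd_addr0.
rewrite multiplierP (_ : multiplier a b = 1) ?nd_mul1r //.
by apply: (nd_mulIr ab); rewrite nd_mul1r [in LHS]swap (multiplier_swap fP).
Qed.
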